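(* Let $X \subset \mathbb{R}^n$ be open, let $\Omega \subset\subset X$ be a bounded domain with $C^2$ boundary, and let $\varphi \in C(\partial\Omega)$. Let $\mathcal{G}$ be either $\mathcal{J}^2(X)$ or a subequation $\mathcal{G} \subsetneq \mathcal{J}^2(X)$, and let $F \in C(\mathcal{G})$ be proper elliptic. Suppose that the set $$\mathcal{F} := \{(x,J) \in \mathcal{G} : F(x,J) \geq 0\}$$ is a subequation and that the compatibility condition $$\operatorname{Int} \mathcal{F} = \{(x,J) \in \mathcal{G} : F(x,J) > 0\}$$ holds. Then for every $h \in C(\overline{\Omega})$: (a) $h$ is $\mathcal{F}$-subharmonic on $\Omega$ if and only if $h$ is a $\mathcal{G}$-admissible viscosity subsolution of $F(J^2 h) = 0$ on $\Omega$; (b) $h$ is $\mathcal{F}$-superharmonic on $\Omega$ (i.e. $-h$ is $\widetilde{\mathcal{F}}$-subharmonic on $\Omega$) if and only if $h$ is a $\mathcal{G}$-admissible viscosity supersolution of $F(J^2 h) = 0$ on $\Omega$. Consequently, the following two formulations of the Dirichlet problem are equivalent: (DP) find $h \in C(\overline{\Omega})$ which is both $\mathcal{F}$-subharmonic and $\mathcal{F}$-superharmonic on $\Omega$ and satisfies $h|_{\partial\Omega} = \varphi$; (DP)$'$ find $h \in C(\overline{\Omega})$ which is both a $\mathcal{G}$-admissible viscosity subsolution and a $\mathcal{G}$-admissible viscosity supersolution of $F(J^2 h) = 0$ on $\Omega$ and satisfies $h|_{\partial\Omega} = \varphi$.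
   Context: Notation. $\mathcal{S}(n)$ is the space of real symmetric $n \times n$ matrices with its usual partial order, $\mathcal{J}^2 := \mathbb{R} \times \mathbb{R}^n \times \mathcal{S}(n)$ is the space of 2-jets, and $\mathcal{J}^2(X) := X \times \mathcal{J}^2$. For $\mathcal{F} \subset \mathcal{J}^2(X)$ and $x \in X$ the fiber is $\mathcal{F}_x := \{J \in \mathcal{J}^2 : (x,J) \in \mathcal{F}\}$. $\operatorname{Int}$ denotes interior (in $\mathcal{J}^2(X)$ for subsets of $\mathcal{J}^2(X)$, in $\mathcal{J}^2$ for fibers), and $c$ denotes complement. Subequation. $\mathcal{F} \subset \mathcal{J}^2(X)$ is a subequation if for every $x \in X$: (P) $(r,p,A) \in \mathcal{F}_x \Rightarrow (r,p,A+P) \in \mathcal{F}_x$ for all $P \geq 0$ in $\mathcal{S}(n)$; (N) $(r,p,A) \in \mathcal{F}_x \Rightarrow (r+s,p,A) \in \mathcal{F}_x$ for all $s \leq 0$; and (T): (T1) $\mathcal{F} = \overline{\operatorname{Int} \mathcal{F}}$, (T2) $\mathcal{F}_x = \overline{\operatorname{Int}(\mathcal{F}_x)}$ for all $x \in X$, (T3) $(\operatorname{Int}\mathcal{F})_x = \operatorname{Int}(\mathcal{F}_x)$ for all $x \in X$. Dual. $\widetilde{\mathcal{F}} := -(\operatorname{Int}\mathcal{F})^c$, where the complement is taken in $\mathcal{J}^2(X)$ and the minus sign acts on the jet component: $(x,J) \in \widetilde{\mathcal{F}} \iff (x,-J) \notin \operatorname{Int}\mathcal{F}$. Proper elliptic.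 $F \in C(\mathcal{G})$ is proper elliptic if for each $x \in X$ and each $(r,p,A) \in \mathcal{G}_x$, $F(x,r,p,A) \leq F(x,r+s,p,A+P)$ for all $s \leq 0$ in $\mathbb{R}$ and all $P \geq 0$ in $\mathcal{S}(n)$. Test jets. For $u$ upper semicontinuous, $J^{2,+}_x u := \{(\phi(x),D\phi(x),D^2\phi(x)) : \phi \text{ is } C^2 \text{ near } x,\ u \leq \phi \text{ near } x \text{ with equality at } x\}$. For $u$ lower semicontinuous, $J^{2,-}_x u$ is defined in the same way with $u \geq \phi$ near $x$ and equality at $x$. Subharmonics and superharmonics. A function $h \in C(\overline{\Omega})$ is $\mathcal{F}$-subharmonic on $\Omega$ if $J^{2,+}_x h \subset \mathcal{F}_x$ for every $x \in \Omega$; it is $\mathcal{F}$-superharmonic on $\Omega$ if $-h$ is $\widetilde{\mathcal{F}}$-subharmonic on $\Omega$, i.e. $J^{2,+}_x(-h) \subset \widetilde{\mathcal{F}}_x$ for every $x \in \Omega$. Admissible viscosity sub/supersolutions. $h$ is a $\mathcal{G}$-admissible viscosity subsolution of $F(J^2h)=0$ on $\Omega$ if for every $x \in \Omega$ and every $J \in J^{2,+}_x h$ one has $J \in \mathcal{G}_x$ and $F(x,J) \geq 0$. $h$ is a $\mathcal{G}$-admissible viscosity supersolution of $F(J^2h)=0$ on $\Omega$ if for every $x \in \Omega$ and every $J \in J^{2,-}_x h$, either $J \in \mathcal{G}_x$ and $F(x,J) \leq 0$, or $J \notin \mathcal{G}_x$. *)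

(* Defs.v *)
From HB Require Import structures.
From mathcomp Require Import all_boot all_order all_algebra.
From mathcomp Require Import all_classical all_reals topology normedtype derive.

Set Implicit Arguments.
Unset Strict Implicit.
Unset Printing Implicit Defensive.

Import Order.TTheory GRing.Theory Num.Theory.
Import numFieldNormedType.Exports.

Local Open Scope classical_set_scope.
Local Open Scope ring_scope.

Section SymmetricMatrices.
Variables (R : realType) (n : nat).

Definition symm_pred : {pred 'M[R]_n} := fun A => A \is symmetricmx.

Record symmx := SymMx {
  symmx_val : 'M[R]_n;
  symmx_valP : symmx_val \in symm_pred
}.

HB.instance Definition _ := [isSub for symmx_val].
HB.instance Definition _ := [Choice of symmx by <:].

Fact symm_pred_zmod_closed : zmod_closed symm_pred.
Proof.
have symE (A : 'M[R]_n) : (A \in symm_pred) = (A == A^T).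
  by rewrite -topredE/= /symm_pred qualifE /= expr0 scale1r map_mx_id.
by split=> [|A B]; rewrite !symE ?trmx0// => /eqP A_sym /eqP B_sym;
  rewrite linearB/= -A_sym -B_sym.
Qed.

HB.instance Definition _ :=
  GRing.isZmodClosed.Build 'M[R]_n symm_pred symm_pred_zmod_closed.
HB.instance Definition _ := [SubChoice_isSubZmodule of symmx by <:].

HB.instance Definition _ :=
  Topological.copy symmx (initial_topology symmx_val).

Definition psd (P : symmx) :=
  forall v : 'rV[R]_n, 0 <= (v *m \val P *m v^T) 0 0.

End SymmetricMatrices.

(* 2-jets (r, p, A), i.e. ((r, p), A). *)
Notation jet R n := (R * 'rV[R]_n * symmx R n)%type.

(* Subsets of the bundle X x J^2 are sets over [set_type X * jet R n], where
   the subtype [set_type X] carries the topology induced from 'rV[R]_n, so that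
   interiors, closures and complements are relative to X x J^2. *)
Section Subequations.
Variables (R : realType) (n : nat) (X : set 'rV[R]_n).
Implicit Types (F G : set (set_type X * jet R n)).

Definition condP F :=
  forall (x : X) (r : R) (p : 'rV[R]_n) (A P : symmx R n),
    F (x, (r, p, A)) -> psd P -> F (x, (r, p, A + P)).

Definition condN F :=
  forall (x : X) (r s : R) (p : 'rV[R]_n) (A : symmx R n),
    F (x, (r, p, A)) -> s <= 0 -> F (x, (r + s, p, A)).

Definition condT F :=
  [/\ F = closure F°,
      forall x : X, xsection F x = closure (xsection F x)° &
      forall x : X, xsection F° x = (xsection F x)°].

Definition subequation F := [/\ condP F, condN F & condT F].

Definition dual F : set (set_type X * jet R n) :=
  [set xJ | ~ F° (xJ.1, - xJ.2)].

(* The values of [f] outside [G] are irrelevant. *)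
Definition proper_elliptic G (f : set_type X * jet R n -> R) :=
  forall (x : X) (r : R) (p : 'rV[R]_n) (A : symmx R n), G (x, (r, p, A)) ->
  forall (s : R) (P : symmx R n), s <= 0 -> psd P ->
    f (x, (r, p, A)) <= f (x, (r + s, p, A + P)).

End Subequations.

Section TestJets.
Variables (R : realType) (n : nat).
Implicit Types (phi u : 'rV[R]_n -> R) (x : 'rV[R]_n).

Definition partial (i : 'I_n) phi : 'rV[R]_n -> R := 'D_(delta_mx 0 i) phi.

Definition gradient phi x : 'rV[R]_n := \row_i partial i phi x.

Definition hessian phi x : 'M[R]_n :=
  \matrix_(i, j) partial j (partial i phi) x.

(* Meant for open [U]: all partial derivatives of order at most 2 exist and
   are continuous at the points of [U]. *)
Definition C2_on (U : set 'rV[R]_n) phi :=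
  forall y, U y ->
    [/\ {for y, continuous phi},
        forall i, derivable phi y (delta_mx 0 i) /\
          {for y, continuous (partial i phi)} &
        forall i j, derivable (partial i phi) y (delta_mx 0 j) /\
          {for y, continuous (partial j (partial i phi))}].

Definition C2_near x phi := exists2 U, open_nbhs x U & C2_on U phi.

Definition upper_jets u x : set (jet R n) :=
  [set J | exists phi, [/\ C2_near x phi,
     \forall y \near x, u y <= phi y, u x = phi x &
     [/\ J.1.1 = phi x, J.1.2 = gradient phi x & \val J.2 = hessian phi x]]].

Definition lower_jets u x : set (jet R n) :=
  [set J | exists phi, [/\ C2_near x phi,
     \forall y \near x, u y >= phi y, u x = phi x &
     [/\ J.1.1 = phi x, J.1.2 = gradient phi x & \val J.2 = hessian phi x]]].

End TestJets.

Section Domains.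
Variables (R : realType) (n : nat).
Implicit Types (X Omega : set 'rV[R]_n).

Definition boundary Omega := closure Omega `\` Omega°.

Definition domain Omega := [/\ open Omega, connected Omega & Omega !=set0].

Definition compactly_contained Omega X :=
  compact (closure Omega) /\ closure Omega `<=` X.

(* Near each boundary point, Omega is the sublevel set of a C^2 function with
   nonvanishing gradient, i.e. it lies on one side of a C^2 hypersurface. *)
Definition C2_boundary Omega :=
  forall x, boundary Omega x -> exists U rho,
    [/\ open_nbhs x U, C2_on U rho,
        forall y, U y -> gradient rho y != 0 &
        Omega `&` U = [set y | rho y < 0] `&` U].

End Domains.

(* Functions in C(closure Omega) are represented by total functions on
   'rV[R]_n, of which only the values on closure Omega matter.  In the four
   notions below, quantifying over [x : X] with [Omega (\val x)] amounts to
   quantifying over the points of Omega when Omega is contained in X. *)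
Section Solutions.
Variables (R : realType) (n : nat) (X Omega : set 'rV[R]_n).
Implicit Types (F G : set (set_type X * jet R n)).
Implicit Types (f : set_type X * jet R n -> R) (h phi : 'rV[R]_n -> R).

Definition subharmonic F h :=
  forall x : X, Omega (\val x) -> upper_jets h (\val x) `<=` xsection F x.

Definition superharmonic F h := subharmonic (dual F) (\- h).

Definition admissible_subsolution G f h :=
  forall x : X, Omega (\val x) ->
  forall J, upper_jets h (\val x) J -> G (x, J) /\ 0 <= f (x, J).

Definition admissible_supersolution G f h :=
  forall x : X, Omega (\val x) ->
  forall J, lower_jets h (\val x) J ->
    (G (x, J) /\ f (x, J) <= 0) \/ ~ G (x, J).

Definition solves_DP F phi h :=
  [/\ {within closure Omega, continuous h},
      subharmonic F h, superharmonic F h &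
      {in boundary Omega, h =1 phi}].

Definition solves_DP' G f phi h :=
  [/\ {within closure Omega, continuous h},
      admissible_subsolution G f h, admissible_supersolution G f h &
      {in boundary Omega, h =1 phi}].

End Solutions.

(* Main.v *)
(* Upper jets of -h are the negatives of lower jets of h, and by compatibility
   a jet -J lies in the dual of F exactly when J fails "J in G and f J > 0",
   which is the alternative defining admissible supersolutions. *)
Require Import Defs.
From HB Require Import structures.
From mathcomp Require Import all_boot all_order all_algebra.
From mathcomp Require Import all_classical all_reals topology normedtype derive.

Import Order.TTheory GRing.Theory Num.Theory.
Import numFieldNormedType.Exports.

Local Open Scope classical_set_scope.
Local Open Scope ring_scope.

(* No derivability is needed: a divergent [lim] in [R] is the default point,
   which is [0]. *)
Lemma partialN {R : realType} {n : nat} (i : 'I_n) (phi : 'rV[R]_n -> R) :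
  partial i (- phi) = - partial i phi.
Proof.
apply/funext => x; have [dphi|ndphi] := pselect (derivable phi x (delta_mx 0 i)).
  exact: deriveN.
have partial0 g : ~ derivable g x (delta_mx 0 i) -> partial i g x = 0 :> R.
  exact: dvgP.
(* If [- phi] were derivable here, so would be its opposite [phi]. *)
rewrite partial0; last by move=> /derivableN; rewrite opprK.
by rewrite -[RHS]/(- (partial i phi x : R)) partial0// oppr0.
Qed.

Lemma gradientN {R : realType} {n : nat} (phi : 'rV[R]_n -> R) x :
  gradient (- phi) x = - gradient phi x.
Proof. by apply/rowP => i; rewrite !mxE partialN. Qed.

(** [partialN] is an equality of functions, so the sign passes through the inner derivative and then
    the outer one. *)
Lemma hessianN {R : realType} {n : nat} (phi : 'rV[R]_n -> R) x :
  hessian (- phi) x = - hessian phi x.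
Proof. by apply/matrixP => i j; rewrite !mxE !partialN. Qed.

Lemma C2_nearN {R : realType} {n : nat} (x : 'rV[R]_n) (phi : 'rV[R]_n -> R) :
  C2_near x phi -> C2_near x (- phi).
Proof.
move=> [U xU phiC2]; exists U; first exact: xU.
move=> y /phiC2[cphi dphi d2phi]; split.
- exact: (continuousN cphi).
- move=> i; have [di ci] := dphi i; rewrite partialN.
  by split; [exact: derivableN|exact: (continuousN ci)].
- move=> i j; have [dij cij] := d2phi i j; rewrite !partialN.
  by split; [exact: derivableN|exact: (continuousN cij)].
Qed.

(** If [phi] touches [- u] from above at [x], then [- phi] touches [u] from below there, and
    conversely; negation also reverses the sign of the whole 2-jet. *)
Lemma upper_jetsN {R : realType} {n : nat} (u : 'rV[R]_n -> R) x (J : jet R n) :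
  upper_jets (\- u) x J <-> lower_jets u x (- J).
Proof.
case: J => -[r p] A; split=> -[phi [C2phi uphi uxphi [/= Jr Jp JA]]];
  exists (- phi); (split; [exact: C2_nearN| | |split]) => /=.
- by apply: filterS uphi => y; rewrite !fctE lerNl.
- by rewrite fctE -uxphi opprK.
- by rewrite Jr.
- by rewrite gradientN Jp.
- by rewrite hessianN -JA.
- by apply: filterS uphi => y; rewrite !fctE lerN2.
- by rewrite fctE uxphi.
- by rewrite fctE -Jr opprK.
- by rewrite gradientN -Jp opprK.
- by rewrite hessianN -JA /= opprK.
Qed.

Lemma subharmonic_admissible {R : realType} {n : nat} (X Omega : set 'rV[R]_n)
    (G F : set (set_type X * jet R n)) (f : set_type X * jet R n -> R) h :
  F = [set xJ | G xJ /\ 0 <= f xJ] ->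
  subharmonic Omega F h <-> admissible_subsolution Omega G f h.
Proof.
by move=> ->; split=> hF x xOmega J /(hF x xOmega); rewrite /xsection/= inE.
Qed.

Lemma superharmonic_admissible {R : realType} {n : nat} (X Omega : set 'rV[R]_n)
    (G F : set (set_type X * jet R n)) (f : set_type X * jet R n -> R) h :
  F° = [set xJ | G xJ /\ 0 < f xJ] ->
  superharmonic Omega F h <-> admissible_supersolution Omega G f h.
Proof.
move=> intFE.
have dualE x J :
    dual F (x, J) <-> (G (x, - J) /\ f (x, - J) <= 0) \/ ~ G (x, - J).
  (* Outside [G] both sides hold; inside [G], totality of the order turns the failure of [0 < f]
     into [f <= 0]. *)
  rewrite /dual /= intFE /=; have [GJ|nGJ] := pselect (G (x, - J)); last first.
    by split=> [_|_ []//]; right.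
  rewrite leNgt; split=> [nGf|[[_ /negP]|]//]; last by move=> fJ [].
  by left; split=> //; apply/negP => fJ; exact: nGf.
split=> hF x xOmega J.
(* Writing [J] as [- - J] makes [- J] an upper jet of [- h], and [dualE] at [- J] then speaks of [J]
   again. *)
- rewrite -[J]opprK => /upper_jetsN/(hF x xOmega).
  by rewrite /xsection/= inE => /dualE.
- by move=> /upper_jetsN/(hF x xOmega)/dualE; rewrite /xsection/= inE.
Qed.

Theorem theorem1p3 (R : realType) (n : nat) (X Omega : set 'rV[R]_n)
    (phi : 'rV[R]_n -> R)
    (G F : set (set_type X * jet R n)) (f : set_type X * jet R n -> R)
    (oX : open X)
    (domOmega : domain Omega) (bndOmega : bounded_set Omega)
    (OmegaX : compactly_contained Omega X) (C2Omega : C2_boundary Omega)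
    (phiC : {within boundary Omega, continuous phi})
    (HG : G = [set: set_type X * jet R n] \/
          subequation G /\ G `<` [set: set_type X * jet R n])
    (fC : {within G, continuous f})
    (ellf : proper_elliptic G f)
    (FE : F = [set xJ | G xJ /\ 0 <= f xJ])
    (subF : subequation F)
    (compat : F° = [set xJ | G xJ /\ 0 < f xJ]) :
  (forall h : 'rV[R]_n -> R, {within closure Omega, continuous h} ->
     (subharmonic Omega F h <-> admissible_subsolution Omega G f h) /\
     (superharmonic Omega F h <-> admissible_supersolution Omega G f h)) /\
  (forall h : 'rV[R]_n -> R,
     solves_DP Omega F phi h <-> solves_DP' Omega G f phi h).
Proof.
have sub h := subharmonic_admissible X Omega G F f h FE.
have super h := superharmonic_admissible X Omega G F f h compat.
(* Continuity and boundary data are common to both problems, so the same [h] solves both once the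
   two middle conditions are exchanged. *)
by split=> [h _ //|h]; split=> -[hC /sub ? /super ? ?].
Qed.
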